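(* Suppose that $(A,M)$ is a self-dual Schur pair such that $A$ is a direct summand of $M$ (as a right $A$-module) and let $e\colon M\to A$ be the natural projection map, viewed as an idempotent of $S=\mathrm{End}_A(M)$. Assume that $e^*=e$. Let $\mu\in\mathscr P$. Then the simple right $S$-module $L^\mu$ is isomorphic to a submodule of the right $S$-module $eS$ if and only if $\mu\in\mathcal K$.
   Context: $K$ is a field; all algebras and modules are finite dimensional over $K$. A Schur pair is a pair $(A,M)$ where $A$ is a self-injective finite dimensional $K$-algebra and $M$ is a faithful finite dimensional right $A$-module; $S=S_A(M)=\mathrm{End}_A(M)$, acting on $M$ from the left. It is assumed that $A$ and $S$ are split over $K$. If $A$ has an anti-involution $*$, the dual of a right $A$-module $X$ is $X^*=\mathrm{Hom}_K(X,K)$ with $(fa)(x)=f(xa^* )$. The Schur pair is self-dual if $A$ is equipped with an anti-involution $*$ such that $M\cong M^*$ as $A$-modules; fix such an isomorphism $\theta\colon M\to M^*$. It induces an anti-isomorphism $s\mapsto s^*$ of $S$ by $s^*=\theta^{-1}\circ s^\tau\circ\theta$, where $s^\tau(f)=f\circ s$ for $f\in M^*$. Let $\{L^\lambda:\lambda\in\mathscr P\}$ be a complete set of pairwise non-isomorphic simple right $S$-modules. Let $\mathsf F(X)=X\otimes_SM$ (a right $A$-module via $(x\otimes m)a=x\otimes ma$) for a right $S$-module $X$; put $D^\lambda=\mathsf F(L^\lambda)$ and $\mathcal K=\{\lambda\in\mathscr P:D^\lambda\ne0\}$. Then $\{D^\mu:\mu\in\mathcal K\}$ is a complete set of pairwise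 non-isomorphic simple right $A$-modules. *)

(* Defs.v *)
From HB Require Import structures.
From mathcomp Require Import all_boot all_algebra all_field.

Set Implicit Arguments.
Unset Strict Implicit.
Unset Printing Implicit Defensive.

Import GRing.Theory.
Local Open Scope ring_scope.

(* Finite dimensional K-algebras are [falgType K]: unital, associative and
   nonzero. Finite dimensional K-spaces are [vectType K]. *)

Section Modules.
Variables (K : fieldType) (B : falgType K).

Record rmodule := RModule {
  rmod_sort :> vectType K;
  ract : {linear B -> 'End(rmod_sort)};
  ract1 : forall x, ract 1 x = x;
  ractM : forall x b c, ract (b * c) x = ract c (ract b x)
}.

End Modules.

Arguments ract {K B} r.
Notation "x *r b" := (ract _ b x)
  (at level 40, left associativity) : ring_scope.

Section ModuleTheory.
Variables (K : fieldType) (B : falgType K).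
Implicit Types (X Y : rmodule B).

Definition rhom X Y (f : 'Hom(X, Y)) :=
  forall (x : X) (b : B), f (x *r b) = f x *r b.

Record riso X Y := RIso {
  riso_fun :> 'Hom(X, Y);
  riso_hom : rhom riso_fun;
  riso_bij : bijective riso_fun
}.

Definition risomorphic X Y := inhabited (riso X Y).

Definition rstable X (U : {vspace X}) :=
  forall (x : X) (b : B), x \in U -> x *r b \in U.

Definition faithful X :=
  forall b : B, (forall x : X, x *r b = 0) -> b = 0.

Definition simple X :=
  (fullv : {vspace X}) != 0%VS /\
  forall U : {vspace X}, rstable U -> U = 0%VS \/ U = fullv.

Definition injective_rmodule (I : rmodule B) :=
  forall (X Y : rmodule B) (f : 'Hom(X, Y)) (g : 'Hom(X, I)),
    rhom f -> injective f -> rhom g ->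
    exists2 h : 'Hom(Y, I), rhom h & forall x, h (f x) = g x.

Record submodule X := SubModule {
  submod_space :> {vspace X};
  submodP : rstable submod_space
}.

Section SubModuleAction.
Variables (X : rmodule B) (U : submodule X).

Definition sub_ract (b : B) : 'End(subvs_of U) :=
  linfun (vsproj U \o ract X b \o vsval).

Lemma sub_ractE b u : vsval (sub_ract b u) = vsval u *r b.
Proof. by rewrite lfunE /= vsprojK // submodP // subvsP. Qed.

Fact sub_ract_linear : linear sub_ract.
Proof.
move=> k b c; apply/lfunP=> u; apply/val_inj.
by rewrite add_lfunE scale_lfunE linearP /= !sub_ractE linearP add_lfunE scale_lfunE.
Qed.
HB.instance Definition _ :=
  GRing.isLinear.Build K B 'End(subvs_of U) _ sub_ract sub_ract_linear.

Fact sub_ract1 u : sub_ract 1 u = u.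
Proof. by apply/val_inj; rewrite /= sub_ractE ract1. Qed.

Fact sub_ractM u b c : sub_ract (b * c) u = sub_ract c (sub_ract b u).
Proof. by apply/val_inj; rewrite /= !sub_ractE ractM. Qed.

Definition submod : rmodule B := RModule sub_ract1 sub_ractM.

End SubModuleAction.

Definition reg_ract (b : B) : 'End(B) := amulr b.

HB.instance Definition _ := GRing.Linear.copy reg_ract (@amulr K B).

Fact reg_ract1 x : reg_ract 1 x = x.
Proof. by rewrite lfunE /= mulr1. Qed.

Fact reg_ractM x b c : reg_ract (b * c) x = reg_ract c (reg_ract b x).
Proof. by rewrite !lfunE /= mulrA. Qed.

Definition regmod : rmodule B := RModule reg_ract1 reg_ractM.

Fact principal_stable (e : B) : rstable (limg (amull e) : {vspace regmod}).
Proof.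
move=> _ b /memv_imgP[x _ ->]; apply/memv_imgP; exists (x * b).
  exact: memvf.
by rewrite /= !lfunE /= mulrA.
Qed.

(* The right ideal eB. *)
Definition principal (e : B) : rmodule B :=
  submod (SubModule (@principal_stable e)).

Definition self_injective := injective_rmodule regmod.

Definition split_algebra :=
  forall X, simple X -> forall f : 'End(X), rhom f -> exists k, f = k *: \1%VF.

Record anti_involution := AntiInvolution {
  ainv :> {linear B -> B};
  ainvM : forall b c, ainv (b * c) = ainv c * ainv b;
  ainvK : involutive ainv
}.

Lemma ainv1 (st : anti_involution) : st 1 = 1.
Proof. by rewrite -[RHS](ainvK st) -[st 1]mulr1 ainvM ainvK mulr1. Qed.

End ModuleTheory.

Section Composition.
Variables (K : fieldType) (U V W : vectType K).

Definition precomp_fun (g : 'Hom(U, V)) (f : 'Hom(V, W)) : 'Hom(U, W) :=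
  (f \o g)%VF.
Fact precomp_linear g : linear (precomp_fun g).
Proof. by move=> k f f'; rewrite /precomp_fun comp_lfunDl comp_lfunZl. Qed.
HB.instance Definition _ g :=
  GRing.isLinear.Build K 'Hom(V, W) 'Hom(U, W) _ (precomp_fun g)
    (precomp_linear g).

Definition postcomp_fun (f : 'Hom(V, W)) (g : 'Hom(U, V)) : 'Hom(U, W) :=
  (f \o g)%VF.
Fact postcomp_linear f : linear (postcomp_fun f).
Proof. by move=> k g g'; rewrite /postcomp_fun comp_lfunDr comp_lfunZr. Qed.
HB.instance Definition _ f :=
  GRing.isLinear.Build K 'Hom(U, V) 'Hom(U, W) _ (postcomp_fun f)
    (postcomp_linear f).

Definition precomp g : 'Hom('Hom(V, W), 'Hom(U, W)) := linfun (precomp_fun g).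
Definition postcomp f : 'Hom('Hom(U, V), 'Hom(U, W)) := linfun (postcomp_fun f).

Lemma precompE g f : precomp g f = (f \o g)%VF. Proof. exact: lfunE. Qed.
Lemma postcompE f g : postcomp f g = (f \o g)%VF. Proof. exact: lfunE. Qed.

End Composition.

Section Dual.
Variables (K : fieldType) (B : falgType K) (st : anti_involution B).
Variable X : rmodule B.

Definition dual_ract (b : B) : 'End('Hom(X, K^o)) := precomp K^o (ract X (st b)).

Lemma dual_ractE b (f : 'Hom(X, K^o)) x : dual_ract b f x = f (x *r st b).
Proof. by rewrite precompE comp_lfunE. Qed.

Fact dual_ract_linear : linear dual_ract.
Proof.
move=> k b c; apply/lfunP=> f; apply/lfunP=> x.
by rewrite !(add_lfunE, scale_lfunE) !dual_ractE linearP linearP add_lfunE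
  scale_lfunE linearP.
Qed.
HB.instance Definition _ :=
  GRing.isLinear.Build K B 'End('Hom(X, K^o)) _ dual_ract dual_ract_linear.

Fact dual_ract1 f : dual_ract 1 f = f.
Proof. by apply/lfunP=> x; rewrite dual_ractE ainv1 ract1. Qed.

Fact dual_ractM f b c : dual_ract (b * c) f = dual_ract c (dual_ract b f).
Proof. by apply/lfunP=> x; rewrite !dual_ractE ainvM ractM. Qed.

Definition dual : rmodule B := RModule dual_ract1 dual_ractM.

End Dual.

Record schur_pair (K : fieldType) (A : falgType K) := SchurPair {
  sp_module :> rmodule A;
  sp_self_injective : self_injective A;
  sp_faithful : faithful sp_module
}.

Section SchurAlgebra.
Variables (K : fieldType) (A : falgType K) (M : schur_pair A).

Definition endv : {vspace 'End(M)} :=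
  (\bigcap_(i < \dim {:A})
     lker (precomp M (ract M (vbasis {:A})`_i)
           - postcomp M (ract M (vbasis {:A})`_i)))%VS.

Lemma endvP (f : 'End(M)) : reflect (rhom f) (f \in endv).
Proof.
apply: (iffP idP) => [/subv_bigcapP fP x a | fM]; last first.
  apply/subv_bigcapP=> i _; rewrite -memvE memv_ker add_lfunE opp_lfunE subr_eq0 precompE.
  by apply/eqP/lfunP=> x; rewrite postcompE !comp_lfunE fM.
have fb (i : 'I_(\dim {:A})) : f (x *r (vbasis {:A})`_i) = f x *r (vbasis {:A})`_i.
  have := fP i isT; rewrite -memvE memv_ker add_lfunE opp_lfunE subr_eq0 precompE.
  by move/eqP/lfunP/(_ x); rewrite postcompE !comp_lfunE.
rewrite (coord_vbasis (memvf a)) !linear_sum /= !sum_lfunE linear_sum /=.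
apply: eq_bigr => i _.
by rewrite !linearZ /= !scale_lfunE linearZ /= fb.
Qed.

(* S_A(M) = End_A(M), with s * t = s \o t, acting on M from the left. *)
Definition endalg : predArgType := subvs_of endv.

HB.instance Definition _ := Vector.on endalg.

Definition endact (s : endalg) : 'End(M) := vsval s.

Definition mkend (f : 'End(M)) (fM : rhom f) : endalg := Subvs (introT (endvP f) fM).

Lemma endact_inj : injective endact. Proof. exact: val_inj. Qed.

Lemma endact_rhom s : rhom (endact s).
Proof. exact/endvP/subvsP. Qed.

Fact endact_linear : linear endact. Proof. by move=> k s t; rewrite /endact linearP. Qed.
HB.instance Definition _ :=
  GRing.isLinear.Build K endalg 'End(M) _ endact endact_linear.

Fact end1_rhom : rhom (\1%VF : 'End(M)).
Proof. by move=> x a; rewrite !id_lfunE. Qed.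

Fact endM_rhom s t : rhom (endact s \o endact t)%VF.
Proof. by move=> x a; rewrite !comp_lfunE !endact_rhom. Qed.

Definition end1 : endalg := mkend end1_rhom.
Definition endM s t : endalg := mkend (endM_rhom s t).

Fact endMA : associative endM.
Proof. by move=> s t u; apply/endact_inj/comp_lfunA. Qed.
Fact end1M : left_id end1 endM.
Proof. by move=> s; apply/endact_inj/comp_lfun1l. Qed.
Fact endM1 : right_id end1 endM.
Proof. by move=> s; apply/endact_inj/comp_lfun1r. Qed.
Fact endMDl : left_distributive endM +%R.
Proof. by move=> s t u; apply/endact_inj/comp_lfunDl. Qed.
Fact endMDr : right_distributive endM +%R.
Proof. by move=> s t u; apply/endact_inj/comp_lfunDr. Qed.

Fact end1_neq0 : end1 != 0.
Proof.
apply/eqP=> /(congr1 endact)/lfunP/= M0; case/eqP: (oner_neq0 A).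
apply: (sp_faithful (s := M)) => x.
by rewrite -[x]id_lfunE M0 !lfunE /= linear0.
Qed.

HB.instance Definition _ := GRing.Zmodule_isNzRing.Build endalg
  endMA end1M endM1 endMDl endMDr end1_neq0.

Fact endZl k (s t : endalg) : k *: (s * t) = (k *: s) * t.
Proof. by apply/endact_inj; rewrite linearZ; apply: comp_lfunZl. Qed.
HB.instance Definition _ := GRing.Lmodule_isLalgebra.Build K endalg endZl.

Fact endZr k (s t : endalg) : k *: (s * t) = s * (k *: t).
Proof. by apply/endact_inj; rewrite linearZ; apply: comp_lfunZr. Qed.
HB.instance Definition _ := GRing.Lalgebra_isAlgebra.Build K endalg endZr.

HB.instance Definition _ := Algebra_isFalgebra.Build K endalg.

Lemma endactM (s t : endalg) m : endact (s * t) m = endact s (endact t m).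
Proof. exact: comp_lfunE. Qed.

Lemma endact1 m : endact 1 m = m. Proof. exact: id_lfunE. Qed.

End SchurAlgebra.

Section Quotient.
Variables (K : fieldType) (V : vectType K) (W : {vspace V}).

(* V / W, carried by a complement of W. *)
Definition quotv : predArgType := subvs_of (W^C)%VS.
HB.instance Definition _ := Vector.on quotv.

Definition quot_pi : 'Hom(V, quotv) :=
  linfun (vsproj (W^C)%VS \o daddv_pi (W^C)%VS W).

Definition quot_repr (u : quotv) : V := vsval u.
Fact quot_repr_linear : linear quot_repr.
Proof. by move=> k u v; rewrite /quot_repr linearP. Qed.
HB.instance Definition _ :=
  GRing.isLinear.Build K quotv V _ quot_repr quot_repr_linear.

Lemma quot_reprK : cancel quot_repr quot_pi.
Proof.
move=> u; apply/val_inj; rewrite lfunE /= daddv_pi_id ?vsprojK ?subvsP //.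
by rewrite capvC capv_compl.
Qed.

Lemma quot_pi_sub v : v - quot_repr (quot_pi v) \in W.
Proof.
have dW : (W^C :&: W = 0)%VS by rewrite capvC capv_compl.
have vW : v \in (W^C + W)%VS by rewrite addvC addv_complf memvf.
rewrite /quot_repr lfunE /= vsprojK ?memv_pi //.
by rewrite -{1}(daddv_pi_add dW vW) addrAC subrr add0r memv_pi.
Qed.

Lemma quot_pi_surj u : exists v, quot_pi v = u.
Proof. by exists (quot_repr u); apply: quot_reprK. Qed.

Lemma quot_pi_eq0 v : (quot_pi v == 0) = (v \in W).
Proof.
apply/eqP/idP=> [v0 | vW].
  by have := quot_pi_sub v; rewrite v0 [quot_repr 0]linear0 subr0.
apply/val_inj; rewrite lfunE /= vsprojK ?memv_pi //.
have dW : (W^C :&: W = 0)%VS by rewrite capvC capv_compl.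
have vWW : v \in (W^C + W)%VS by rewrite addvC addv_complf memvf.
have := daddv_pi_add dW vWW.
rewrite [daddv_pi W _ v]daddv_pi_id ?capv_compl // => /(canRL (addrK _)).
by rewrite subrr.
Qed.

End Quotient.

Section Tensor.
Variables (K : fieldType) (A : falgType K) (M : schur_pair A).
Variable X : rmodule (endalg M).

(* X (x)_K M, realised as Hom_K(Hom_K(X, K), M) through
   x (x) m |-> (f |-> f(x) m). *)
Definition tensK : vectType K := 'Hom('Hom(X, K^o), M).

Definition pureK_fun (x : X) (m : M) (f : 'Hom(X, K^o)) : M := (f x : K) *: m.
Fact pureK_fun_linear x m : linear (pureK_fun x m).
Proof.
by move=> k f g; rewrite /pureK_fun add_lfunE scale_lfunE scalerDl scalerA.
Qed.
HB.instance Definition _ x m :=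
  GRing.isLinear.Build K 'Hom(X, K^o) M _ (pureK_fun x m) (pureK_fun_linear x m).

Definition pureK (x : X) (m : M) : tensK := linfun (pureK_fun x m).

Lemma pureKE x m f : pureK x m f = (f x : K) *: m.
Proof. exact: lfunE. Qed.

Lemma pureK_linearl m : linear (pureK^~ m).
Proof.
move=> k x y; apply/lfunP=> f.
by rewrite add_lfunE scale_lfunE !pureKE linearP scalerDl scalerA.
Qed.

Lemma pureK_linearr x : linear (pureK x).
Proof.
move=> k m n; apply/lfunP=> f.
by rewrite add_lfunE scale_lfunE !pureKE scalerDr !scalerA mulrC.
Qed.

Definition balance (x : X) (s : endalg M) (m : M) : tensK :=
  pureK (x *r s) m - pureK x (endact s m).

(* The span of all [balance x s m]; bases suffice by trilinearity, see
   [mem_balancev]. *)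
Definition balancev : {vspace tensK} :=
  (\sum_(i < \dim {:X}) \sum_(j < \dim {:endalg M}) \sum_(k < \dim {:M})
     <[balance (vbasis {:X})`_i (vbasis {:endalg M})`_j (vbasis {:M})`_k]>)%VS.

Lemma balance_linear1 s m : linear (fun x => balance x s m).
Proof.
move=> k x y; rewrite /balance linearP !pureK_linearl.
by rewrite scalerBr opprD addrACA.
Qed.

Lemma balance_linear2 x m : linear (fun s => balance x s m).
Proof.
move=> k s t; rewrite /balance linearP add_lfunE scale_lfunE pureK_linearl.
by rewrite linearP add_lfunE scale_lfunE pureK_linearr scalerBr opprD addrACA.
Qed.

Lemma balance_linear3 x s : linear (balance x s).
Proof.
move=> k m n; rewrite /balance linearP !pureK_linearr.
by rewrite scalerBr opprD addrACA.
Qed.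

Lemma linear_basis_mem (U : vectType K) (V : vectType K) (W : {vspace V})
    (f : U -> V) :
  linear f -> (forall i : 'I_(\dim {:U}), f (vbasis {:U})`_i \in W) ->
  forall u, f u \in W.
Proof.
move=> lf fW u.
pose g : {linear U -> V} := HB.pack f (GRing.isLinear.Build K U V _ f lf).
rewrite -[f u]/(g u) (coord_vbasis (memvf u)) (linear_sum g).
by apply: memv_suml => i _; rewrite (linearZ_LR g) memvZ // -[g _]/(f _) fW.
Qed.

Lemma mem_balancev x s m : balance x s m \in balancev.
Proof.
apply: (linear_basis_mem (balance_linear1 s m)) => i.
apply: (linear_basis_mem (balance_linear2 _ m)) => j.
apply: (linear_basis_mem (balance_linear3 _ _)) => k.
rewrite memvE /balancev (sumv_sup i) // (sumv_sup j) // (sumv_sup k) //.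
Qed.

Lemma balancev_min (W : {vspace tensK}) :
  (forall x s m, balance x s m \in W) -> (balancev <= W)%VS.
Proof. by move=> bW; do 3!apply/subv_sumP=> ? _; rewrite -memvE. Qed.

Definition tens : vectType K := quotv balancev.

Definition pure (x : X) (m : M) : tens := quot_pi balancev (pureK x m).

Lemma pure_linearl m : linear (pure^~ m).
Proof. by move=> k x y; rewrite /pure pureK_linearl linearP. Qed.

Lemma pure_linearr x : linear (pure x).
Proof. by move=> k m n; rewrite /pure pureK_linearr linearP. Qed.

Lemma pure_balanced x s m : pure (x *r s) m = pure x (endact s m).
Proof.
by apply/eqP; rewrite -subr_eq0 -linearB quot_pi_eq0; apply: mem_balancev.
Qed.

(* The A-action on X (x)_K M: postcomposition sends x (x) m to x (x) ma. *)
Definition actK (a : A) : 'End(tensK) := postcomp _ (ract M a).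

Lemma actK_pureK a x m : actK a (pureK x m) = pureK x (m *r a).
Proof. by apply/lfunP=> f; rewrite postcompE comp_lfunE !pureKE linearZ. Qed.

Lemma actK_balancev a t : t \in balancev -> actK a t \in balancev.
Proof.
move=> tW; apply: (subvP _ _ (memv_img (actK a) tW)).
rewrite limg_sum; apply/subv_sumP=> i _; rewrite limg_sum.
apply/subv_sumP=> j _; rewrite limg_sum; apply/subv_sumP=> k _.
rewrite limg_line -memvE /balance linearB /= !actK_pureK -endact_rhom.
exact: mem_balancev.
Qed.

Definition tens_ract (a : A) : 'End(tens) :=
  linfun (quot_pi balancev \o actK a \o @quot_repr _ _ balancev).

Lemma tens_ract_pi a t :
  tens_ract a (quot_pi balancev t) = quot_pi balancev (actK a t).
Proof.
rewrite lfunE /=; apply/eqP; rewrite -subr_eq0 -!linearB quot_pi_eq0.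
by rewrite actK_balancev // -memvN opprB quot_pi_sub.
Qed.

Fact tens_ract_linear : linear tens_ract.
Proof.
move=> k a b; apply/lfunP=> u; have [t <-] := quot_pi_surj u.
rewrite add_lfunE scale_lfunE !tens_ract_pi -linearP; congr (quot_pi _ _).
apply/lfunP=> f; rewrite add_lfunE scale_lfunE !postcompE !comp_lfunE.
by rewrite linearP add_lfunE scale_lfunE.
Qed.
HB.instance Definition _ :=
  GRing.isLinear.Build K A 'End(tens) _ tens_ract tens_ract_linear.

Fact tens_ract1 u : tens_ract 1 u = u.
Proof.
have [t <-] := quot_pi_surj u; rewrite tens_ract_pi; congr (quot_pi _ _).
by apply/lfunP=> f; rewrite postcompE comp_lfunE ract1.
Qed.

Fact tens_ractM u a b : tens_ract (a * b) u = tens_ract b (tens_ract a u).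
Proof.
have [t <-] := quot_pi_surj u; rewrite !tens_ract_pi; congr (quot_pi _ _).
by apply/lfunP=> f; rewrite !postcompE !comp_lfunE ractM.
Qed.

(* F(X) = X (x)_S M. *)
Definition functorF : rmodule A := RModule tens_ract1 tens_ractM.

Lemma functorF_act (x : X) (m : M) (a : A) :
  (pure x m : functorF) *r a = pure x (m *r a).
Proof. by rewrite /= tens_ract_pi actK_pureK. Qed.

Definition dcoord i : 'Hom(X, K^o) := linfun (coord (vbasis {:X}) i : X -> K^o).

Lemma tensK_sum (t : tensK) :
  t = \sum_(i < \dim {:X}) pureK (vbasis {:X})`_i (t (dcoord i)).
Proof.
apply/lfunP=> f; rewrite sum_lfunE.
have -> : f = \sum_(i < \dim {:X}) (f (vbasis {:X})`_i : K) *: dcoord i.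
  apply/lfunP=> x; rewrite sum_lfunE {1}(coord_vbasis (memvf x)) linear_sum.
  by apply: eq_bigr => i _; rewrite linearZ scale_lfunE [dcoord _ _]lfunE; apply: mulrC.
rewrite linear_sum; apply: eq_bigr => i _; rewrite linearZ pureKE; congr (_ *: _).
rewrite sum_lfunE (bigD1 i) //= big1 => [|j ji];
  rewrite scale_lfunE [dcoord _ _]lfunE /= coord_free ?(basis_free (vbasisP _)) //.
  by rewrite eqxx addr0; apply/esym/mulr1.
by rewrite eq_sym (negPf ji); apply: mulr0.
Qed.

(* Universal property of X (x)_S M among K-spaces. *)
Lemma tens_univ (V : vectType K) (b : X -> M -> V) :
    (forall m, linear (b^~ m)) -> (forall x, linear (b x)) ->
    (forall x s m, b (x *r s) m = b x (endact s m)) ->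
  exists2 h : 'Hom(tens, V), forall x m, h (pure x m) = b x m &
    forall h' : 'Hom(tens, V), (forall x m, h' (pure x m) = b x m) -> h' = h.
Proof.
move=> bl br bS.
pose h0f (t : tensK) : V := \sum_(i < \dim {:X}) b (vbasis {:X})`_i (t (dcoord i)).
have h0l : linear h0f.
  move=> k t u; rewrite /h0f scaler_sumr -big_split; apply: eq_bigr => i _.
  by rewrite add_lfunE scale_lfunE br.
have [h0 h0E] : exists h0 : 'Hom(tensK, V), forall t, h0 t = h0f t.
  exists (linfun (HB.pack_for {linear tensK -> V} h0f
                    (GRing.isLinear.Build K tensK V _ h0f h0l))) => t.
  exact: lfunE.
have h0p x m : h0 (pureK x m) = b x m.
  pose bm : {linear X -> V} :=
    HB.pack (b^~ m) (GRing.isLinear.Build K X V _ (b^~ m) (bl m)).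
  pose bx y : {linear M -> V} :=
    HB.pack (b y) (GRing.isLinear.Build K M V _ (b y) (br y)).
  rewrite h0E -[RHS]/(bm x) {2}(coord_vbasis (memvf x)) (linear_sum bm).
  apply: eq_bigr => i _; rewrite pureKE (linearZ_LR bm) /= lfunE /=.
  exact: (linearZ_LR (bx _)).
have h0W t : t \in balancev -> h0 t = 0.
  move=> tW; apply/eqP; rewrite -memv_ker; apply: subvP t tW.
  by apply: balancev_min => x s m; rewrite memv_ker /balance linearB /= !h0p bS subrr.
exists (h0 \o linfun (@quot_repr _ _ balancev))%VF => [x m|h' hp].
  rewrite comp_lfunE lfunE /= -h0p; apply/eqP; rewrite -subr_eq0 -linearB.
  by apply/eqP/h0W; rewrite -memvN opprB quot_pi_sub.
apply/lfunP=> u; rewrite comp_lfunE lfunE /= -[in LHS](quot_reprK u).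
set t := quot_repr u; rewrite (tensK_sum t) !linear_sum; apply: eq_bigr => i _.
by rewrite /= h0p -hp.
Qed.

End Tensor.

Section SelfDual.
Variables (K : fieldType) (A : falgType K) (M : schur_pair A).
Variables (st : anti_involution A) (theta : riso M (dual st M)).

Definition transp (s : endalg M) : 'End('Hom(M, K^o)) := precomp K^o (endact s).

Definition end_star_fun (s : endalg M) : 'End(M) :=
  (theta^-1 \o transp s \o theta)%VF.

Fact theta_ker0 : lker theta == 0%VS.
Proof. by apply/lker0P/bij_inj/riso_bij. Qed.

Fact thetaVK : cancel (theta^-1)%VF theta.
Proof.
move=> f; have [g _ gK] := riso_bij theta.
by rewrite -[f]gK lker0_lfunK ?theta_ker0.
Qed.

Fact end_star_rhom s : rhom (end_star_fun s).
Proof.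
move=> x a; apply: (bij_inj (riso_bij theta)).
rewrite [RHS](riso_hom theta) !comp_lfunE !thetaVK (riso_hom theta).
apply/lfunP=> y; rewrite /= !(dual_ractE, precompE, comp_lfunE).
by rewrite endact_rhom.
Qed.

(* s^* = theta^-1 o s^tau o theta *)
Definition end_star (s : endalg M) : endalg M := mkend (end_star_rhom s).

Lemma end_starE s m : theta (endact (end_star s) m) = (theta m \o endact s)%VF.
Proof.
rewrite -[endact _]/(end_star_fun s) !comp_lfunE thetaVK.
exact: precompE.
Qed.

Lemma end_starM s t : end_star (s * t) = end_star t * end_star s.
Proof.
apply/endact_inj/lfunP=> x; apply: (bij_inj (riso_bij theta)).
rewrite endactM !end_starE; apply/lfunP=> y.
by rewrite comp_lfunE endactM !comp_lfunE.
Qed.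

End SelfDual.

Record direct_summand (K : fieldType) (B : falgType K) (X M : rmodule B) :=
  DirectSummand {
    ds_incl : 'Hom(X, M);
    ds_hom : rhom ds_incl;
    ds_inj : injective ds_incl;
    ds_compl : submodule M;
    ds_cap : (limg ds_incl :&: ds_compl = 0)%VS;
    ds_sum : (limg ds_incl + ds_compl = fullv)%VS
  }.

Section SummandIdempotent.
Variables (K : fieldType) (A : falgType K) (M : schur_pair A).
Variable D : direct_summand (regmod A) M.

Definition ds_proj : 'End(M) := daddv_pi (limg (ds_incl D)) (ds_compl D).

Fact ds_proj_rhom : rhom ds_proj.
Proof.
move=> x a; have dI := ds_cap D; have dC := dI; rewrite capvC in dC.
have xI : x \in (limg (ds_incl D) + ds_compl D)%VS by rewrite ds_sum memvf.
rewrite -{1}(daddv_pi_add dI xI) !linearD /=.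
have IA : ds_proj x *r a \in limg (ds_incl D).
  have /memv_imgP[b _ ->] := memv_pi (limg (ds_incl D)) (ds_compl D) x.
  by rewrite -ds_hom memv_img ?memvf.
rewrite [ds_proj (_ *r a)](daddv_pi_id dI) // -[RHS]addr0; congr (_ + _).
have CA := submodP a (memv_pi (ds_compl D) (limg (ds_incl D)) x).
set y := _ *r a in CA *.
have yI : y \in (limg (ds_incl D) + ds_compl D)%VS by rewrite ds_sum memvf.
have := daddv_pi_add dI yI; rewrite [daddv_pi (ds_compl D) _ y]daddv_pi_id //.
by move/(canRL (addrK _)); rewrite subrr.
Qed.

(* The natural projection M -> A, viewed in S through the inclusion A -> M. *)
Definition summand_idem : endalg M := mkend ds_proj_rhom.

Lemma summand_idem_idem : summand_idem * summand_idem = summand_idem.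
Proof.
apply/endact_inj/lfunP=> x; rewrite endactM.
exact: daddv_pi_proj (ds_cap D).
Qed.

End SummandIdempotent.

Definition complete_simples (K : fieldType) (B : falgType K) (P : Type)
    (L : P -> rmodule B) :=
  [/\ forall lambda, simple (L lambda),
      forall lambda mu, risomorphic (L lambda) (L mu) -> lambda = mu
    & forall X, simple X -> exists lambda, risomorphic X (L lambda)].

(* D^mu = F(L^mu) is nonzero. *)
Definition survives (K : fieldType) (A : falgType K) (M : schur_pair A)
    (P : Type) (L : P -> rmodule (endalg M)) (mu : P) :=
  (fullv : {vspace functorF (L mu)}) != 0%VS.

(* Main.v *)
Require Import Defs.
From HB Require Import structures.
From mathcomp Require Import all_boot all_algebra all_field.

(** Write S for End_A(M). Both sides of the equivalence are about S-maps out of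
    L^mu, through the adjunction of tensor product and Hom: an S-map
    g : L^mu -> S is the same thing as an A-map h : F(L^mu) -> M, related by
    h(x (x) m) = g(x)(m), and g takes its values in eS exactly when h takes its
    values in eM, a copy of A ([hom_curry], [hom_uncurry]).

    If L^mu embeds in eS, the embedding corresponds to a nonzero map out of
    F(L^mu), which is therefore nonzero.

    Conversely, since L^mu is simple, it is enough to produce a nonzero S-map
    L^mu -> eS, that is, a nonzero A-map N -> eM for N = F(L^mu) <> 0. Such a
    map exists for every N <> 0 ([hom_to_summand]). Indeed the form
    <m, n> = theta(m)(n) on M satisfies <s^* m, n> = <m, s n>, so e^* = e makes
    it nondegenerate on eM; hence A, being isomorphic to eM, is isomorphic to
    its own dual A^*. A nonzero functional f on N gives the A-map N -> A^*
    sending n to (a |-> f(n a^* )), which is nonzero because f is. *)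

Set Implicit Arguments.
Unset Strict Implicit.
Unset Printing Implicit Defensive.

Import GRing.Theory.
Local Open Scope ring_scope.

Section LinearMaps.
Variables (K : fieldType) (U V : vectType K).

Lemma linear_lfun (f : U -> V) : linear f -> {g : 'Hom(U, V) | g =1 f}.
Proof.
move=> lf; exists (linfun (HB.pack_for {linear U -> V} f
  (GRing.isLinear.Build K U V _ f lf))) => u; exact: lfunE.
Qed.

Lemma exists_functional (v : V) : v != 0 -> exists f : 'Hom(V, K^o), f v != 0.
Proof.
move=> v0; have [i vi | c0] := pickP (fun i => coord (vbasis {:V}) i v != 0).
  by exists (linfun (coord (vbasis {:V}) i : V -> K^o)); rewrite lfunE.
case/eqP: v0; rewrite (coord_vbasis (memvf v)) big1 // => i _.
by have /negbFE/eqP-> := c0 i; rewrite scale0r.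
Qed.

End LinearMaps.

Section Homs.
Variables (K : fieldType) (B : falgType K) (X Y : rmodule B).

Lemma simple_hom_inj (g : 'Hom(X, Y)) (x : X) :
  simple X -> rhom g -> g x != 0 -> injective g.
Proof.
move=> [_ sX] gB gx; apply/lker0P.
have kerP : rstable (lker g).
  by move=> y b; rewrite !memv_ker gB => /eqP->; rewrite linear0.
case: (sX _ kerP) => [->// | kg]; case/negP: gx.
by rewrite -memv_ker kg memvf.
Qed.

Lemma corestrict_hom (W : submodule Y) (g : 'Hom(X, Y)) :
    rhom g -> (forall x, g x \in (W : {vspace Y})) ->
  exists2 h : 'Hom(X, submod W), rhom h & forall x, vsval (h x) = g x.
Proof.
move=> gB gW; pose h : 'Hom(X, submod W) := linfun (vsproj W \o g).
have hE x : vsval (h x) = g x by rewrite lfunE /= vsprojK.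
by exists h => // x b; apply: val_inj; rewrite /= sub_ractE !hE gB.
Qed.

Lemma submod_incl_hom (W : submodule Y) (h : 'Hom(X, submod W)) :
    rhom h ->
  exists2 g : 'Hom(X, Y), rhom g & forall x, g x = vsval (h x).
Proof.
move=> hB; pose g : 'Hom(X, Y) := linfun (vsval \o h).
have gE x : g x = vsval (h x) by rewrite lfunE.
by exists g => // x b; rewrite !gE hB -sub_ractE.
Qed.

Lemma inj_hom_submod (g : 'Hom(X, Y)) :
  rhom g -> injective g -> exists V : submodule Y, risomorphic X (submod V).
Proof.
move=> gB gi.
have imgP : rstable (limg g).
  move=> _ b /memv_imgP[x _ ->]; rewrite -gB.
  exact: memv_img (memvf _).
pose V := SubModule imgP; exists V.
have [|h hB hE] := @corestrict_hom V g gB.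
  by move=> x; exact: memv_img (memvf _).
suff hb : bijective h by split; exists h.
exists (fun u => (g^-1)%VF (vsval u)) => [x | u].
  by rewrite hE lker0_lfunK //; apply/lker0P.
by apply: val_inj; rewrite /= hE limg_lfunVK // subvsP.
Qed.

End Homs.

Section Adjunction.
Variables (K : fieldType) (A : falgType K) (M : schur_pair A).
Variable X : rmodule (endalg M).

Lemma tens_lfun_neq0 (V : vectType K) (f : 'Hom(tens X, V)) u :
  f u != 0 -> exists x, exists m, f (pure x m) != 0.
Proof.
have [t <-] := quot_pi_surj u; rewrite (tensK_sum t) !linear_sum => fu.
pose d (i : 'I_(\dim {:X})) := pure (vbasis {:X})`_i (t (dcoord i)).
have [i fi | f0] := pickP (fun i => f (d i) != 0).
  by do 2!eexists; exact: fi.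
case/eqP: fu; apply: big1 => i _; exact/eqP/negbFE/f0.
Qed.

(** The half of the tensor-Hom adjunction that turns an A-map out of F(X) into
    the S-map x |-> (m |-> h(x (x) m)): each value commutes with A because h
    does, and S-linearity in x is the balancing relation of the tensor
    product. *)
Lemma hom_curry (h : 'Hom(functorF X, M)) :
    rhom h ->
  exists2 g : 'Hom(X, regmod (endalg M)), rhom g
    & forall x m, endact (g x) m = h (pure x m).
Proof.
move=> hA.
have hx x : {k : 'End(M) | k =1 fun m => h (pure x m)}.
  by apply: linear_lfun => k m n; rewrite pure_linearr linearP.
have hxA x : rhom (sval (hx x)).
  by move=> m a; rewrite !(svalP (hx x)) -functorF_act hA.
have [|g gE] := @linear_lfun K X (regmod (endalg M)) (fun x => mkend (hxA x)).
  move=> k x y; apply/endact_inj/lfunP=> m.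
  rewrite linearP add_lfunE scale_lfunE /= !(svalP (hx _)).
  by rewrite pure_linearl linearP.
have gxE x m : endact (g x) m = h (pure x m).
  by rewrite gE -[endact _]/(sval (hx x)) (svalP (hx x)).
exists g => // x s; apply/endact_inj/lfunP=> m.
by rewrite /= lfunE /= endactM !gxE pure_balanced.
Qed.

(** The other half of the adjunction. It is used only to see that F(X) is
    nonzero, so h is produced merely as a K-linear map. *)
Lemma hom_uncurry (g : 'Hom(X, regmod (endalg M))) :
    rhom g ->
  exists h : 'Hom(tens X, M), forall x m, h (pure x m) = endact (g x) m.
Proof.
move=> gS; have [| | |h hE _] := @tens_univ _ _ _ X M
  (fun x m => endact (g x) m).
- by move=> m k x y; rewrite !linearP add_lfunE scale_lfunE.
- by move=> x k m n; rewrite linearP.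
- by move=> x s m; rewrite gS /= lfunE /= endactM.
by exists h.
Qed.

End Adjunction.

Section SelfDualSummand.
Variables (K : fieldType) (A : falgType K) (M : schur_pair A).
Variables (st : anti_involution A) (theta : riso M (dual st M)).
Variable D : direct_summand (regmod A) M.
Local Notation e := (summand_idem D).

(** The projection M -> A itself, whereas [ds_proj] and [summand_idem] are its
    composite with the inclusion A -> M. *)
Definition summand_coord : 'Hom(M, regmod A) :=
  ((ds_incl D)^-1 \o ds_proj D)%VF.

Lemma ds_incl_coord m : ds_incl D (summand_coord m) = endact e m.
Proof. by rewrite comp_lfunE limg_lfunVK // memv_pi. Qed.

Lemma summand_coord_idem m : summand_coord (endact e m) = summand_coord m.
Proof.
by apply: (ds_inj (d := D)); rewrite !ds_incl_coord -endactM summand_idem_idem.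
Qed.

Lemma summand_coord_hom : rhom summand_coord.
Proof.
move=> m a; apply: (ds_inj (d := D)).
by rewrite ds_hom !ds_incl_coord endact_rhom.
Qed.

Lemma summand_coord_incl a : summand_coord (ds_incl D a) = a.
Proof.
apply: (ds_inj (d := D)); rewrite ds_incl_coord.
by rewrite [LHS](daddv_pi_id (ds_cap D)) // memv_img ?memvf.
Qed.

(** With beta : M -> A the projection and <m, n> = theta(m)(n), the map h is
    defined by <h(n), m> = f(n beta(m)^* ); it is A-linear because
    a beta(m)^* = beta(m a^* )^* and <h(n) a, m> = <h(n), m a^* >. The
    right-hand side depends only on beta(m) = beta(e m), so
    <h(n), m> = <h(n), e m> = <e^* h(n), m>, and e^* = e puts h(n) in eM.
    Taking m to be the unit of the summand A recovers f(n), so that h does not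
    vanish where f does not. *)
Lemma hom_to_summand (N : rmodule A) (f : 'Hom(N, K^o)) :
    end_star theta e = e ->
  exists h : 'Hom(N, M), [/\ rhom h, forall n, endact e (h n) = h n
    & forall n, f n != 0 -> h n != 0].
Proof.
move=> eK.
(* The functional m |-> f(n beta(m)^* ), shown linear in m and then in n. *)
have phi n : {k : 'Hom(M, K^o) | k =1 fun m => f (n *r st (summand_coord m))}.
  apply: linear_lfun => k m m'.
  by rewrite !linearP add_lfunE scale_lfunE linearP.
have [|G GE] := @linear_lfun K N 'Hom(M, K^o) (fun n => sval (phi n)).
  move=> k n n'; apply/lfunP=> m.
  by rewrite add_lfunE scale_lfunE !(svalP (phi _)) !linearP.
pose h := (theta^-1 \o G)%VF.
have hE n m : theta (h n) m = f (n *r st (summand_coord m)).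
  by rewrite comp_lfunE thetaVK GE (svalP (phi n)).
have theta_inj := bij_inj (riso_bij theta).
exists h; split=> [n a | n | n].
- apply: theta_inj; rewrite riso_hom; apply/lfunP=> m.
  by rewrite /= dual_ractE !hE summand_coord_hom /= [reg_ract _ _]lfunE /=
    ainvM ainvK ractM.
- apply: theta_inj; rewrite -{1}eK end_starE; apply/lfunP=> m.
  by rewrite comp_lfunE !hE summand_coord_idem.
(* [ds_incl D 1] is the unit of the copy of A inside M. *)
apply: contraNneq => h0; have := hE n (ds_incl D 1).
by rewrite h0 linear0 lfunE /= summand_coord_incl ainv1 ract1 => <-.
Qed.

End SelfDualSummand.

Theorem theorem2p17 (K : fieldType) (A : falgType K) (M : schur_pair A)
  (splitA : split_algebra A) (splitS : split_algebra (endalg M))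
  (st : anti_involution A) (theta : riso M (dual st M))
  (P : Type) (L : P -> rmodule (endalg M)) (HL : complete_simples L)
  (D : direct_summand (regmod A) M)
  (He : end_star theta (summand_idem D) = summand_idem D)
  (mu : P) :
  (exists V : submodule (principal (summand_idem D)),
     risomorphic (L mu) (submod V))
  <-> survives L mu.
Proof.
case: HL => /(_ mu) sL _ _; split.
  case=> V [phi]; have [/negP sL0 _] := sL; apply/negP=> /eqP F0; apply: sL0.
  have [g1 g1S g1E] := submod_incl_hom (riso_hom phi).
  have [g gS gE] := submod_incl_hom g1S.
  have [h hE] := hom_uncurry gS.
  (* If F(L^mu) = 0 then h = 0, so g = 0 since M is faithful over S; g being
     injective, L^mu = 0. *)
  rewrite -subv0; apply/subvP=> x _; rewrite memv0.
  suff gx0 : g x = 0.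
    apply/eqP/(bij_inj (riso_bij phi)); rewrite linear0.
    apply/val_inj/val_inj; transitivity (g x); first by rewrite gE g1E.
    exact: gx0.
  apply/endact_inj/lfunP=> m; rewrite -hE.
  have /eqP-> : pure x m == 0 :> tens (L mu) by rewrite -memv0 -F0 memvf.
  by rewrite !linear0 lfunE.
rewrite /survives -vpick0; set v := vpick _ => v0.
have [f fv] := exists_functional v0.
have [h [hA he hf]] := hom_to_summand f He.
have [x [m hxm]] := tens_lfun_neq0 (hf _ fv).
have [g gS gE] := hom_curry hA.
have ge y : g y \in limg (amull (summand_idem D)).
  apply/memv_imgP; exists (g y); first exact: memvf.
  by apply/endact_inj/lfunP=> n; rewrite [amull _ _]lfunE [RHS]endactM gE he.
have [g' g'S g'E] := @corestrict_hom _ _ _ _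
  (SubModule (@principal_stable _ _ (summand_idem D))) _ gS ge.
apply: (inj_hom_submod g'S); apply: (simple_hom_inj (x := x) sL g'S).
apply: contraNneq hxm => g0; rewrite -gE -g'E g0.
by rewrite linear0 /= lfunE.
Qed.
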